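(* Let $\mathcal{I}_0=(R_{[T]},p_{[T]},T)$ be a finite-horizon MDP instance with even horizon $T$ and rewards in $[0,\bar r]$, and let $\mu_0$ be an initial distribution. If there exists $\epsilon\in[0,1)$ such that $\tau_\epsilon(\mathcal{I}_0)\le T/2$, then the regret of temporal concatenation satisfies $$\Delta(\mathcal{I}_0,\mu_0)\le \frac{\bar r\,\tau_\epsilon(\mathcal{I}_0)}{1-\epsilon}.$$ In particular, if $\tau_0(\mathcal{I}_0)\le T/2$, then $\Delta(\mathcal{I}_0,\mu_0)\le \bar r\,\tau_0(\mathcal{I}_0)$.
   Context: Notation: $[n]=\{0,1,\dots,n-1\}$; $\delta_{\rm TV}(\mu,\nu)=\frac12\sum_s|\mu(s)-\nu(s)|$. MDP instance. Fix a discrete (at most countable) state space $\mathcal{S}$ and action set $\mathcal{A}$. An instance $\mathcal{I}=(R_{[T]},p_{[T]},T)$ with horizon $T\in\mathbb{N}$ consists of transition functions $p_t$ and reward functions $R_t$, $t\in[T]$. The state evolves as $S_{t+1}=p_t(a_t,S_t,Y^S_t)$, $t\in[T]$, with $Y^S_t$ i.i.d. uniform on a finite set $\mathcal{Y}^S$, and $S_0\sim\mu_0$. The reward in slot $t$ is $R_t(a_t,S_t,Y^R_t)\in[0,\bar r]$, where $\bar r\ge 0$ is a constant and $Y_t^R$ are i.i.d. with a fixed distribution on a finite set $\mathcal{Y}^R$. A policy $\pi$ selects $a_t=\pi(t,S_t,Y^P)$ with $Y^P$ uniform on $[0,1]$. The variables $S_0,(Y^S_t)_t,(Y^R_t)_t,Y^P$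 are independent. The total expected reward is $V(\mathcal{I},\pi,\mu_0)=\mathbb{E}^\pi_{S_0\sim\mu_0}\big[\sum_{t=0}^{T-1}R_t(a_t,S_t,Y^R_t)\big]$. A policy is optimal for $\mathcal{I}$ if it attains the maximum of $V(\mathcal{I},\cdot,\mu_0)$ for every $\mu_0$; optimal policies are assumed to exist for the instances considered. Temporal concatenation ($T$ even). Let $\mathcal{I}_1$ be the horizon-$T/2$ instance with rewards and transitions $R_t,p_t$, $0\le t\le T/2-1$, and $\mathcal{I}_2$ the horizon-$T/2$ instance with rewards and transitions $R_{t},p_{t}$, $T/2\le t\le T-1$ (re-indexed to start at $0$). Let $\pi_1^*,\pi_2^*$ be optimal policies for $\mathcal{I}_1,\mathcal{I}_2$. The policy $\pi_{\rm TC}$ uses $\pi_1^*(t,S_t,Y^P_1)$ for $0\le t\le T/2-1$ and $\pi_2^*(t-T/2,S_t,Y^P_2)$ for $T/2\le t\le T-1$, where $Y_1^P,Y_2^P$ are independent uniform variables on $[0,1]$ obtained from $Y^P$ (odd and even binary digits). Regret. $\Delta(\mathcal{I}_0,\mu_0)=V(\mathcal{I}_0,\pi^*,\mu_0)-V(\mathcal{I}_0,\pi_{\rm TC},\mu_0)$, where $\pi^*$ is an optimal policy for $\mathcal{I}_0$. $\epsilon$-diameter. Let $\mathcal{P}$ be the set of probability distributions on $\mathcal{S}$. For $\epsilon\in[0,1]$, $\mathcal{P}^{t_0}_\epsilon(\mu,t)$ is the set of $\nu\in\mathcal{P}$ for which there is a policy $\pi$ such that, if the state at time $t_0$ has distribution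 $\mu$ and $\pi$ is used, the distribution $\mu^\pi_{t_0+t}$ of $S_{t_0+t}$ satisfies $\delta_{\rm TV}(\mu^\pi_{t_0+t},\nu)\le\epsilon$. Then $$\tau_\epsilon(\mathcal{I})=\inf\{t\ge 0:\ \nu'\in\mathcal{P}_\epsilon^{t_0}(\nu,t)\text{ for all }\nu,\nu'\in\mathcal{P}\text{ and all }t_0\in[T-t]\},$$ with $t$ ranging over integers. *)

(* Defs.v *)
From mathcomp Require Import all_boot all_order all_algebra.
From mathcomp Require Import all_classical all_reals all_analysis.

Set Implicit Arguments.
Unset Strict Implicit.
Unset Printing Implicit Defensive.

Import Order.TTheory GRing.Theory Num.Theory.
Import numFieldNormedType.Exports.

Local Open Scope classical_set_scope.
Local Open Scope ring_scope.

Definition is_pmf (R : realType) (X : choiceType) (mu : X -> R) : Prop :=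
  (forall x, 0 <= mu x) /\ (\esum_(x in [set: X]) (mu x)%:E = 1)%E.

Definition tv_dist (R : realType) (X : choiceType) (mu nu : X -> R) : \bar R :=
  ((2^-1)%:E * \esum_(x in [set: X]) (`|mu x - nu x|)%:E)%E.

(* [bindigit y k] is, for [1 <= k], the [k]-th digit of [y] in [0, 1) after the
   binary point (the expansion ending in zeros for dyadic [y]). *)
Definition bindigit (R : realType) (y : R) (k : nat) : bool :=
  odd (Num.truncn (2 ^+ k * y)).

Definition odd_digits (R : realType) (y : R) : R :=
  limn (series (fun j : nat => (bindigit y j.*2.+1)%:R / 2 ^+ j.+1 : R) :
    nat -> R).

Definition even_digits (R : realType) (y : R) : R :=
  limn (series (fun j : nat => (bindigit y j.*2.+2)%:R / 2 ^+ j.+1 : R) :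
    nat -> R).

Section MDP.
Context (R : realType) (S A : countType) (YS YR : finType).

(* Only the values of [reward] and [trans] at times [t < horizon] matter. *)
Record mdp := MDP {
  horizon : nat;
  reward : nat -> A -> S -> YR -> R;
  trans : nat -> A -> S -> YS -> S }.

Definition rewards_in (I : mdp) (rbar : R) : Prop :=
  forall t a s z, (t < horizon I)%N -> 0 <= reward I t a s z <= rbar.

(* [pi t s y] is the action chosen at time [t] in state [s] when the policy
   randomness Y^P, drawn once for all time slots, equals [y] in [0, 1]. *)
Definition policy := nat -> S -> R -> A.

(* The action [pi t s Y^P] is a random element of the discrete space [A]. *)
Definition admissible (pi : policy) : Prop :=
  forall t s (B : set A), measurable (`[0, 1]%classic `&` pi t s @^-1` B).

(* State reached from state [s] at time [t] under successive noises [ys]. *)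
Fixpoint run (I : mdp) (pi : policy) (y : R) (t : nat) (s : S) (ys : seq YS) :
    S :=
  if ys is z :: ys' then run I pi y t.+1 (trans I t (pi t s y) s z) ys' else s.

(* Expectation of a nonnegative [f s ys y] when [s] has law [mu], [ys] consists
   of [n] uniform draws from [YS], [y] is uniform on [0, 1], and all of these
   are independent. *)
Definition expect (mu : S -> R) (n : nat) (f : S -> n.-tuple YS -> R -> R) :
    \bar R :=
  (\int[@lebesgue_measure R]_(y in `[0%R, 1%R])
    \esum_(s in [set: S])
      (mu s * \sum_(ys : n.-tuple YS) (#|YS|%:R^-1 ^+ n * f s ys y))%:E)%E.

(* Law of the state at time [t0 + t] if the state at time [t0] has law [mu]. *)
Definition state_law (I : mdp) (pi : policy) (t0 : nat) (mu : S -> R) (t : nat) :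
    S -> R :=
  fun s' => fine (expect mu
    (fun s (ys : t.-tuple YS) y => (run I pi y t0 s ys == s')%:R)).

(* The reward noises are independent with law [q]. *)
Definition value (q : YR -> R) (I : mdp) (pi : policy) (mu0 : S -> R) :
    \bar R :=
  expect mu0 (fun s (ys : (horizon I).-tuple YS) y =>
    \sum_(yr : (horizon I).-tuple YR)
      (\prod_(t < horizon I) q (tnth yr t)) *
      \sum_(t < horizon I)
        let st := run I pi y 0 s (take t ys) in
        reward I t (pi t st y) st (tnth yr t)).

Definition optimal (q : YR -> R) (I : mdp) (pi : policy) : Prop :=
  admissible pi /\
  forall mu0, is_pmf mu0 -> forall pi', admissible pi' ->
    (value q I pi' mu0 <= value q I pi mu0)%E.

Definition first_half (I : mdp) : mdp :=
  MDP (horizon I)./2 (reward I) (trans I).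

Definition second_half (I : mdp) : mdp :=
  MDP (horizon I)./2
    (fun t => reward I ((horizon I)./2 + t)%N)
    (fun t => trans I ((horizon I)./2 + t)%N).

Definition temporal_concat (T : nat) (pi1 pi2 : policy) : policy :=
  fun t s y =>
    if (t < T./2)%N then pi1 t s (odd_digits y)
    else pi2 (t - T./2)%N s (even_digits y).

Definition regret (q : YR -> R) (I : mdp) (piopt pi1 pi2 : policy)
    (mu0 : S -> R) : \bar R :=
  (value q I piopt mu0 -
   value q I (temporal_concat (horizon I) pi1 pi2) mu0)%E.

Definition eps_reachable (I : mdp) (eps : R) (t0 : nat) (mu : S -> R) (t : nat) :
    set (S -> R) :=
  [set nu | is_pmf nu /\ exists pi, admissible pi /\
    (tv_dist (state_law I pi t0 mu t) nu <= eps%:E)%E].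

Definition within_diameter (I : mdp) (eps : R) (t : nat) : Prop :=
  forall nu nu' : S -> R, is_pmf nu -> is_pmf nu' ->
  forall t0, (t0 < horizon I - t)%N -> eps_reachable I eps t0 nu t nu'.

(* [t = horizon I] qualifies vacuously, so the infimum is a minimum. *)
Lemma within_diameter_exists (I : mdp) (eps : R) :
  exists t, `[< within_diameter I eps t >].
Proof.
by exists (horizon I); apply/asboolP => nu nu' _ _ t0; rewrite subnn.
Qed.

Definition eps_diameter (I : mdp) (eps : R) : nat :=
  ex_minn (within_diameter_exists I eps).

End MDP.

(* Main.v *)
(* Let W be the Bellman value of the second half, as a function of the state at
   time T/2.  Two facts suffice.
   Oscillation: the Bellman value from any time u oscillates by at most
   C = rbar * tau / (1 - eps).  From a state s, steer towards a state x that
   nearly maximizes the value from time u + tau on; this succeeds with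
   probability at least 1 - eps, and a failure costs at most the oscillation at
   time u + tau.  Hence osc_u <= rbar * tau + eps * osc_(u + tau), and C is the
   fixed point of this recursion.
   Conditioning on Y^P: a policy is a mixture of deterministic policies, none of
   which beats the Bellman value, so under an optimal policy almost every slice
   attains the Bellman value at every state.  The maps sending y to its odd or
   even digits pull null sets back to null sets, so almost every slice of the
   temporal concatenation earns at least W1(s) + inf W, where W1 is the Bellman
   value of the first half, whereas every policy earns at most W1(s) + sup W. *)

Require Import Defs.
From mathcomp Require Import all_boot all_order all_algebra.
From mathcomp Require Import all_classical all_reals all_analysis.
From mathcomp Require Import measurable_realfun.
From mathcomp Require Import ring lra zify.
Set Implicit Arguments.
Unset Strict Implicit.
Unset Printing Implicit Defensive.
Import Order.TTheory GRing.Theory Num.Theory.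
Import numFieldNormedType.Exports.
Local Open Scope classical_set_scope.
Local Open Scope ring_scope.

(** * Bellman recursion *)

Section Average.
Context (R : realType) (Y : finType).
Implicit Types f g : Y -> R.

Definition avg f : R := #|Y|%:R^-1 * \sum_y f y.

Lemma le_avg f g : (forall y, f y <= g y) -> avg f <= avg g.
Proof. by move=> fg; rewrite ler_wpM2l ?invr_ge0 ?ler0n// ler_sum. Qed.

Lemma avgD f g : avg (fun y => f y + g y) = avg f + avg g.
Proof. by rewrite /avg big_split mulrDr. Qed.

Lemma avgZ c f : avg (fun y => c * f y) = c * avg f.
Proof. by rewrite /avg -mulr_sumr mulrCA. Qed.

Lemma avg_cst c : (0 < #|Y|)%N -> avg (fun=> c) = c.
Proof.
move=> Y0; rewrite /avg sumr_const -[c *+ _]mulr_natl mulrA mulVf ?mul1r//.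
by rewrite pnatr_eq0 -lt0n.
Qed.

End Average.

Section DynamicProgramming.
Context (R : realType) (S A : countType) (Y : finType).
Variable trans : nat -> A -> S -> Y -> S.
Implicit Types (rew : nat -> A -> S -> R) (d : nat -> S -> A) (f g : S -> R).

Definition qval rew u a f s : R := rew u a s + avg (fun z => f (trans u a s z)).

(** Keeping both the reward [rew] and the terminal payoff [g] free serves two purposes: mean rewards
    with [g = 0] give expected earnings, and zero rewards with an indicator [g] give the probability
    of ending in a state. *)
Fixpoint pval rew d n u g s : R :=
  if n is n'.+1 then qval rew u (d u s) (pval rew d n' u.+1 g) s else g s.

(** A supremum, since [A] may be infinite and no action need be maximal. It has its meaning only on
    nonempty sets bounded above, which [a0] and the reward bound secure below. *)
Fixpoint oval rew n u g s : R :=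
  if n is n'.+1 then sup (range (fun a => qval rew u a (oval rew n' u.+1 g) s))
  else g s.

Lemma le_qval rew rew' u a f g s : rew u a s <= rew' u a s ->
  (forall s, f s <= g s) -> qval rew u a f s <= qval rew' u a g s.
Proof. by move=> rr fg; rewrite lerD// le_avg. Qed.

Lemma le_pval rew rew' d n u f g s :
  (forall t a s, (t < u + n)%N -> rew t a s <= rew' t a s) ->
  (forall s, f s <= g s) -> pval rew d n u f s <= pval rew' d n u g s.
Proof.
elim: n u s => [|n IH] u s rr fg //=.
apply: le_qval => [|s'].
  by apply/rr; rewrite addnS ltnS leq_addr.
by apply: IH => // t a s'' tn; apply: rr; rewrite addnS -addSn.
Qed.

Lemma pval_add rew d n m u g s :
  pval rew d (n + m) u g s = pval rew d n u (pval rew d m (u + n) g) s.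
Proof.
elim: n u s => [|n IH] u s /=; first by rewrite addn0.
rewrite addnS -addSn; congr (qval _ _ _ _ _).
by apply/funext => s'; rewrite IH.
Qed.

Lemma oval_add rew n m u g s :
  oval rew (n + m) u g s = oval rew n u (oval rew m (u + n) g) s.
Proof.
elim: n u s => [|n IH] u s /=; first by rewrite addn0.
rewrite addnS -addSn; apply: (congr1 (fun F => sup (range F))); apply/funext => a.
by congr (qval _ _ _ _ _); apply/funext => s'; rewrite IH.
Qed.

Lemma eq_pval d d' rew n u g s :
  (forall t s, (u <= t < u + n)%N -> d t s = d' t s) ->
  pval rew d n u g s = pval rew d' n u g s.
Proof.
elim: n u s => [|n IH] u s dd //=.
rewrite dd ?leqnn/= ?addnS ?ltnS ?leq_addr//.
congr (qval _ _ _ _ _); apply/funext => s'; apply: IH => t s'' /andP[ut tn].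
by apply: dd; rewrite ltnW//= addnS -addSn.
Qed.

Hypothesis Y_gt0 : (0 < #|Y|)%N.

Lemma pvalDc rew d n u g c s :
  pval rew d n u (fun s => g s + c) s = pval rew d n u g s + c.
Proof.
elim: n u s => [|n IH] u s //=; rewrite /qval -addrA; congr (_ + _).
rewrite -[X in _ + X](avg_cst c Y_gt0) -avgD; congr avg.
by apply/funext => z; rewrite IH.
Qed.

(** Without rewards the recursion is a plain expectation of the terminal payoff. This later turns a
    payoff that singles out one target state into a hitting probability. *)
Lemma pval0_affine d n u g b c s :
  pval (fun _ _ _ => 0) d n u (fun s => b + c * g s) s =
  b + c * pval (fun _ _ _ => 0) d n u g s.
Proof.
elim: n u s => [|n IH] u s //=; rewrite /qval !add0r -avgZ.
rewrite -[X in X + _](avg_cst b Y_gt0) -avgD; congr avg.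
by apply/funext => z; rewrite IH.
Qed.

(** * Bounded rewards: range of the values, and near-optimal deterministic policies *)

Section Bounded.
Variables (rew : nat -> A -> S -> R) (T : nat) (rb : R) (a0 : A).
Hypothesis rew_bd : forall t a s, (t < T)%N -> 0 <= rew t a s <= rb.

Lemma qval_bd u a f M s : (u < T)%N -> (forall s, 0 <= f s <= M) ->
  0 <= qval rew u a f s <= rb + M.
Proof.
move=> uT fM; have /andP[r0 rr] := rew_bd a s uT.
rewrite /qval addr_ge0//= ?lerD//.
- rewrite -[leRHS](avg_cst M Y_gt0); apply: le_avg => z.
  by have /andP[] := fM (trans u a s z).
- rewrite -[leLHS](avg_cst 0 Y_gt0); apply: le_avg => z.
  by have /andP[] := fM (trans u a s z).
Qed.

Lemma oval_bd n u g M s : (u + n <= T)%N -> (forall s, 0 <= g s <= M) ->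
  0 <= oval rew n u g s <= rb * n%:R + M.
Proof.
move=> + gM; elim: n u s => [|n IH] u s unT /=; first by rewrite mulr0 add0r.
have uT : (u < T)%N by rewrite (leq_trans _ unT)// addnS ltnS leq_addr.
have fM s' : 0 <= oval rew n u.+1 g s' <= rb * n%:R + M.
  by apply: IH; rewrite addSn -addnS.
have bd a := qval_bd a s uT fM.
set E := [set _ | _ in _].
have nE : E !=set0 by exists (qval rew u a0 (oval rew n u.+1 g) s), a0.
have uE : ubound E (rb * n.+1%:R + M).
  by move=> _ [a _ <-]; have /andP[_] := bd a; rewrite mulrSr mulrDr mulr1; lra.
apply/andP; split; last exact: ge_sup.
have /andP[h _] := bd a0; apply: (le_trans h).
by apply: ub_le_sup; [exists (rb * n.+1%:R + M) | exists a0].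
Qed.

Lemma qval_le_oval n u g M a s : (u + n.+1 <= T)%N ->
  (forall s, 0 <= g s <= M) ->
  qval rew u a (oval rew n u.+1 g) s <= oval rew n.+1 u g s.
Proof.
move=> unT gM; apply: ub_le_sup; last by exists a.
exists (rb + (rb * n%:R + M)) => _ [b _ <-].
have uT : (u < T)%N by rewrite (leq_trans _ unT)// addnS ltnS leq_addr.
have fM s' : 0 <= oval rew n u.+1 g s' <= rb * n%:R + M.
  by apply: oval_bd => //; rewrite addSn -addnS.
by have /andP[] := qval_bd b s uT fM.
Qed.

Lemma pval_le_oval d n u g M s : (u + n <= T)%N -> (forall s, 0 <= g s <= M) ->
  pval rew d n u g s <= oval rew n u g s.
Proof.
move=> + gM; elim: n u s => [|n IH] u s unT //.
apply: le_trans (qval_le_oval (d u s) s unT gM).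
by apply: le_qval => // s'; apply: IH; rewrite addSn -addnS.
Qed.

Lemma pval_ge0 d n u g s : (u + n <= T)%N -> (forall s, 0 <= g s) ->
  0 <= pval rew d n u g s.
Proof.
move=> + g0; elim: n u s => [|n IH] u s unT //=.
have uT : (u < T)%N by rewrite (leq_trans _ unT)// addnS ltnS leq_addr.
have /andP[r0 _] := rew_bd (d u s) s uT.
rewrite addr_ge0// -[leLHS](avg_cst 0 Y_gt0); apply: le_avg => z.
by apply: IH; rewrite addSn -addnS.
Qed.

(** At each time and state an action within [delta] of the supremum is fixed once and for all; the
    losses add up to [delta] per remaining stage. *)
Lemma near_optimal g M (delta : R) : 0 < delta -> (forall s, 0 <= g s <= M) ->
  exists d, forall n u s, (u + n = T)%N ->
    oval rew n u g s - delta * n%:R <= pval rew d n u g s.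
Proof.
move=> d0 gM.
have ex t s : exists a, (t < T)%N ->
    oval rew (T - t) t g s - delta <=
    qval rew t a (oval rew (T - t.+1) t.+1 g) s.
  (* From the horizon on nothing is required, and [a0] is a placeholder. *)
  have [tT|] := ltnP t T; last by exists a0.
  have -> : (T - t = (T - t.+1).+1)%N by lia.
  have [_ [a _ <-] h] : exists2 x, range (fun a =>
      qval rew t a (oval rew (T - t.+1) t.+1 g) s) x &
      oval rew (T - t.+1).+1 t g s - delta < x.
    apply: sup_adherent => //.
    split; first by exists (qval rew t a0 (oval rew (T - t.+1) t.+1 g) s), a0.
    exists (oval rew (T - t.+1).+1 t g s) => _ [b _ <-].
    by apply: (@qval_le_oval _ _ _ M) => //; lia.
  by exists a => _; exact: ltW.
have [d dP] : {d : nat -> S -> A | forall t s, (t < T)%N ->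
    oval rew (T - t) t g s - delta <=
    qval rew t (d t s) (oval rew (T - t.+1) t.+1 g) s}.
  exists (fun t s => projT1 (cid (ex t s))) => t s.
  exact: (projT2 (cid (ex t s))).
exists d; elim=> [|n IH] u s unT /=; first by rewrite mulr0 subr0.
have uT : (u < T)%N by lia.
have := dP u s uT; have -> : (T - u.+1 = n)%N by lia.
have -> : (T - u = n.+1)%N by lia.
move=> h; suff : qval rew u (d u s) (oval rew n u.+1 g) s - delta * n%:R
   <= qval rew u (d u s) (pval rew d n u.+1 g) s.
  move: h; rewrite /= mulrSr mulrDr mulr1; lra.
rewrite /qval -addrA lerD2l -[X in _ + X](avg_cst _ Y_gt0) -avgD.
by apply: le_avg => z; apply: IH; lia.
Qed.

End Bounded.

End DynamicProgramming.

Lemma pval_shift (R : realType) (S A : countType) (Y : finType)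
    (trans : nat -> A -> S -> Y -> S) (rew : nat -> A -> S -> R)
    (d : nat -> S -> A) (m n u : nat) (g : S -> R) :
  pval (fun t => trans (m + t)%N) (fun t => rew (m + t)%N)
    (fun t => d (m + t)%N) n u g = pval trans rew d n (m + u)%N g.
Proof. by elim: n u => [|n IH] u //=; apply/funext => s; rewrite IH addnS. Qed.

Lemma oval_shift (R : realType) (S A : countType) (Y : finType)
    (trans : nat -> A -> S -> Y -> S) (rew : nat -> A -> S -> R)
    (m n u : nat) (g : S -> R) :
  oval (fun t => trans (m + t)%N) (fun t => rew (m + t)%N) n u g =
  oval trans rew n (m + u)%N g.
Proof. by elim: n u => [|n IH] u //=; apply/funext => s; rewrite IH addnS. Qed.

(** * Values as integrals of policy evaluations *)

Lemma sum_tuple_cons (V : nmodType) (X : finType) n (F : n.+1.-tuple X -> V) :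
  \sum_t F t = \sum_x \sum_(t : n.-tuple X) F [tuple of x :: t].
Proof.
rewrite pair_big /= (reindex (fun p : X * n.-tuple X => [tuple of p.1 :: p.2])).
  by apply: eq_bigr => -[x t].
exists (fun t => (thead t, [tuple of behead t])) => [[x t]|t] _ /=.
  by congr pair; apply: val_inj.
by rewrite -tuple_eta.
Qed.

Lemma sum_tuple_prod_marginal (R : comPzRingType) (X : finType) n (q : X -> R)
    (i : 'I_n) (F : X -> R) : \sum_x q x = 1 ->
  \sum_(t : n.-tuple X) (\prod_j q (tnth t j)) * F (tnth t i) =
  \sum_x q x * F x.
Proof.
move=> q1.
(* [F] is attached to coordinate [i] alone, so that the sum factorizes over coordinates and every
   other factor sums to 1. *)
pose G (j : 'I_n) x := q x * (if j == i then F x else 1).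
transitivity (\sum_(f : {ffun 'I_n -> X}) \prod_j G j (f j)).
  rewrite (reindex (fun f : {ffun 'I_n -> X} => [tuple f j | j < n])) /=.
    apply: eq_bigr => f _; rewrite /G big_split/=; congr (_ * _).
      by apply: eq_bigr => j _; rewrite tnth_mktuple.
    by rewrite -big_mkcond big_pred1_eq tnth_mktuple.
  exists (fun t => [ffun j => tnth t j]) => [f|t] _.
    by apply/ffunP => j; rewrite ffunE tnth_mktuple.
  by apply: eq_from_tnth => j; rewrite tnth_mktuple ffunE.
rewrite -bigA_distr_bigA (bigD1 i)//= [X in _ * X]big1 ?mulr1.
  by apply: eq_bigr => x _; rewrite /G eqxx.
move=> j ji; rewrite -[RHS]q1; apply: eq_bigr => x _.
by rewrite /G (negbTE ji) mulr1.
Qed.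

Section TupleAverage.
Context (R : realType) (Y : finType).

Definition tavg n (F : n.-tuple Y -> R) : R :=
  \sum_(ys : n.-tuple Y) #|Y|%:R^-1 ^+ n * F ys.

Lemma tavg0 (F : 0.-tuple Y -> R) : tavg F = F [tuple].
Proof.
rewrite /tavg (bigD1 [tuple]) //= big1 ?addr0 ?expr0 ?mul1r//.
by move=> t; rewrite tuple0.
Qed.

Lemma tavgS n (F : n.+1.-tuple Y -> R) :
  tavg F = avg (fun z => tavg (fun ys : n.-tuple Y => F [tuple of z :: ys])).
Proof.
rewrite /tavg /avg sum_tuple_cons mulr_sumr; apply: eq_bigr => z _.
by rewrite mulr_sumr; apply: eq_bigr => ys _; rewrite exprS mulrA.
Qed.

Lemma tavgD n (F G : n.-tuple Y -> R) :
  tavg (fun ys => F ys + G ys) = tavg F + tavg G.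
Proof. by rewrite -big_split; apply: eq_bigr => ys _; rewrite mulrDr. Qed.

Lemma tavg_cst n (c : R) : (0 < #|Y|)%N -> tavg (fun _ : n.-tuple Y => c) = c.
Proof.
move=> Y0; elim: n => [|n IH]; first by rewrite tavg0.
by rewrite tavgS IH avg_cst.
Qed.

End TupleAverage.

Section Evaluation.
Context (R : realType) (S A : countType) (YS YR : finType).
Variables (q : YR -> R) (I : mdp R S A YS YR).
Implicit Types pi : policy R S A.

Definition mean_reward t a s : R := \sum_z q z * reward I t a s z.

(** Splitting off the first noise of the tuple separates the reward at time [u] from the run that
    restarts at [u.+1], which is one step of the recursion. *)
Lemma tavg_run_rewards (rew : nat -> A -> S -> R) pi y n u s :
  (0 < #|YS|)%N ->
  tavg (fun ys : n.-tuple YS => \sum_(t < n)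
    let st := run I pi y u s (take t ys) in rew (u + t)%N (pi (u + t)%N st y) st)
  = pval (trans I) rew (fun t s => pi t s y) n u (fun=> 0) s.
Proof.
move=> YS0; elim: n u s => [|n IH] u s; first by rewrite tavg0 big_ord0.
under [X in tavg X]eq_fun do rewrite big_ord_recl.
rewrite tavgD /= addn0.
under [X in tavg X + _]eq_fun do rewrite take0 /=.
rewrite tavg_cst// tavgS; congr (_ + avg _).
apply/funext => z /=; rewrite -IH; congr tavg; apply/funext => ys.
by apply: eq_bigr => t _; rewrite /= /bump leq0n add1n addnS -addSn.
Qed.

Lemma tavg_run_final pi y n u (g : S -> R) s :
  tavg (fun ys : n.-tuple YS => g (run I pi y u s ys)) =
  pval (trans I) (fun _ _ _ => 0) (fun t s => pi t s y) n u g s.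
Proof.
elim: n u s => [|n IH] u s; first by rewrite tavg0.
by rewrite tavgS /= /qval add0r; congr avg; apply/funext => z; rewrite -IH.
Qed.

(** Each reward depends on a single reward noise, so the product law enters only through its
    marginals and the rewards average to [mean_reward]; for fixed [y] the rest is a policy
    evaluation. *)
Lemma valueE pi mu : (0 < #|YS|)%N -> \sum_z q z = 1 ->
  value q I pi mu = (\int[@lebesgue_measure R]_(y in `[0%R, 1%R])
    \esum_(s in [set: S]) (mu s * pval (trans I) mean_reward
       (fun t s => pi t s y) (horizon I) 0 (fun=> 0) s)%:E)%E.
Proof.
move=> YS0 q1; rewrite /value /expect; apply: eq_integral => y _.
apply: eq_esum => s _; rewrite -tavg_run_rewards//; congr (_ * _)%:E.
apply: eq_bigr => ys _; congr (_ * _).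
under eq_bigr do rewrite mulr_sumr.
rewrite exchange_big/=; apply: eq_bigr => t _.
rewrite (sum_tuple_prod_marginal t (fun z =>
  reward I t (pi t (run I pi y 0 s (take t ys)) y) (run I pi y 0 s (take t ys)) z))//.
Qed.

Lemma state_lawE pi t0 mu t s' :
  state_law I pi t0 mu t s' = fine (\int[@lebesgue_measure R]_(y in `[0%R, 1%R])
    \esum_(s in [set: S]) (mu s * pval (trans I) (fun _ _ _ => 0)
       (fun t s => pi t s y) t t0 (fun x => (x == s')%:R) s)%:E)%E.
Proof.
rewrite /state_law /expect; congr fine; apply: eq_integral => y _.
by apply: eq_esum => s _; rewrite -tavg_run_final.
Qed.

End Evaluation.

(** * Odd and even binary digits *)

(** The domain splits into the countably many pieces on which [a] is constant, and on each piece the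
    function is a single [G x]. *)
Lemma measurable_fun_discrete d d' (T : measurableType d) (U : measurableType d')
    (X : countType) (D : set T) (a : T -> X) (G : X -> T -> U) :
  measurable D -> (forall x, measurable (D `&` a @^-1` [set x])) ->
  (forall x, measurable_fun D (G x)) -> measurable_fun D (fun t => G (a t) t).
Proof.
move=> mD ma mG _ B mB.
rewrite (_ : _ `&` _ =
    \bigcup_(x in [set: X]) ((D `&` a @^-1` [set x]) `&` (D `&` G x @^-1` B))).
  apply: countable_bigcupT_measurable => [|x]; first exact: countableP.
  by apply: measurableI => //; exact: mG.
apply/seteqP; split => [t [Dt Bt]|t [x _ [[Dt <-] [_ Bt]]]]; last by [].
by exists (a t).
Qed.

Section BinaryDigits.
Context (R : realType).
Local Notation mu := (@lebesgue_measure R).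
Implicit Types y : R.

(** Doubling shifts the binary expansion by one place, so the integer part receives the next digit
    as its lowest bit. *)
Lemma truncn_double (x : R) : 0 <= x ->
  Num.truncn (2 * x) = ((Num.truncn x).*2 + odd (Num.truncn (2 * x)))%N.
Proof.
move=> x0; suff : ((Num.truncn (2 * x))./2 = Num.truncn x)%N.
  by move=> <-; rewrite addnC odd_double_half.
have x20 : 0 <= 2 * x by rewrite mulr_ge0.
set m := Num.truncn (2 * x); apply/esym/truncn_def.
have /andP[l u] := truncn_itv x20; rewrite -/m in l u.
have := odd_double_half m; set k := m./2 => mE.
have mk : m%:R = (odd m)%:R + 2 * k%:R :> R.
  by rewrite -{1}mE natrD -mul2n natrM.
move: l u; rewrite -[m.+1%:R]natr1 -[k.+1%:R]natr1 mk.
case: (odd m) => /= l u; apply/andP; split.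
all: lra.
Qed.

(* [e = 0] selects the digits in odd positions, [e = 1] those in even ones. *)
Variable e : nat.

Definition digit_series y : nat -> R :=
  series (fun j : nat => (bindigit y (e + j.*2.+1))%:R / 2 ^+ j.+1 : R).

Definition digit_prefix y : nat -> nat :=
  fix p n := if n is n'.+1 then ((p n').*2 + bindigit y (e + n'.*2.+1))%N else 0%N.

Lemma digit_seriesE y n : digit_series y n = (digit_prefix y n)%:R / 2 ^+ n.
Proof.
elim: n => [|n IH]; first by rewrite /digit_series /series/= big_geq// mul0r.
move: IH; rewrite /digit_series /series/= big_nat_recr//= => ->.
rewrite natrD -[(digit_prefix y n).*2]mul2n natrM exprS; field.
by rewrite expf_neq0.
Qed.

Lemma digit_series_nondecreasing y :
  {homo digit_series y : n m / (n <= m)%N >-> n <= m}.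
Proof.
apply/nondecreasing_seqP => n; rewrite /digit_series /series/= big_nat_recr//=.
by rewrite lerDl divr_ge0// exprn_ge0.
Qed.

(** Each new digit is at most 1, so the right ends of the successive dyadic intervals never
    increase. *)
Lemma digit_series_tail y n m :
  digit_series y (n + m) + (2 ^+ (n + m))^-1 <= digit_series y n + (2 ^+ n)^-1.
Proof.
elim: m => [|m IH]; first by rewrite addn0.
apply: le_trans IH; rewrite addnS /digit_series /series/= big_nat_recr//=.
rewrite -addrA lerD2l.
have p0 : 0 < (2 ^+ (n + m))^-1 :> R by rewrite invr_gt0 exprn_gt0.
have -> : (2 ^+ (n + m).+1)^-1 = (2 ^+ (n + m))^-1 / 2 :> R.
  by rewrite exprS invfM mulrC.
by case: bindigit; rewrite /= ?mul0r ?mul1r; lra.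
Qed.

Lemma digit_series_ub y n m :
  digit_series y m <= digit_series y n + (2 ^+ n)^-1.
Proof.
have [nm|/ltnW mn] := leqP n m.
  apply: le_trans (digit_series_tail y n (m - n)); rewrite subnKC//.
  by rewrite lerDl invr_ge0 exprn_ge0.
apply: le_trans (digit_series_nondecreasing y mn) _.
by rewrite lerDl invr_ge0 exprn_ge0.
Qed.

Lemma is_cvg_digit_series y : cvgn (digit_series y).
Proof.
apply: nondecreasing_is_cvgn; first exact: digit_series_nondecreasing.
by exists (digit_series y 0 + (2 ^+ 0)^-1) => _ [m _ <-]; exact: digit_series_ub.
Qed.

(** The right end must be included: the limit reaches it when all later selected digits are 1. *)
Lemma digit_limit_itv y n :
  (digit_prefix y n)%:R / 2 ^+ n <= limn (digit_series y) <=
  (digit_prefix y n).+1%:R / 2 ^+ n.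
Proof.
apply/andP; split.
  rewrite -digit_seriesE.
  exact: nondecreasing_cvgn_le (@digit_series_nondecreasing y)
    (@is_cvg_digit_series y) n.
apply: limr_le; first exact: is_cvg_digit_series.
apply: nearW => m; apply: le_trans (digit_series_ub y n m) _.
by rewrite digit_seriesE -[(digit_prefix y n).+1%:R]natr1 mulrDl mul1r.
Qed.

Hypothesis e01 : (e <= 1)%N.

(* The [m < 4 ^ n] for which the [n] digits of parity [e] among the [2 * n]
   binary digits of [m] spell [k]. *)
Fixpoint cells n k : seq nat :=
  if n is n'.+1 then
    flatten [seq [:: (4 * m + (if e == 0 then 2 * odd k else odd k))%N;
                     (4 * m + (if e == 0 then 2 * odd k + 1 else 2 + odd k))%N]
            | m <- cells n' k./2]
  else [:: 0%N].

(** Every selected digit comes with one free digit, hence two choices per step. *)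
Lemma size_cells n k : size (cells n k) = (2 ^ n)%N.
Proof.
elim: n k => [|n IH] k //=.
rewrite expnS -(IH k./2); elim: (cells n k./2) => //= m s ->.
by rewrite mulnS.
Qed.

(** Passing from [n] to [n.+1] appends a pair of binary digits to the integer part of [4 ^+ n * y],
    one selected and one free; the four possible pairs are checked for each parity. *)
Lemma truncn_cells y n : 0 <= y < 1 ->
  Num.truncn (4 ^+ n * y) \in cells n (digit_prefix y n).
Proof.
move=> /andP[y0 y1]; elim: n => [|n IH] /=.
  by rewrite expr0 mul1r inE; apply/eqP/truncn_def; rewrite y0.
have step k : Num.truncn (2 ^+ k.+1 * y) =
    ((Num.truncn (2 ^+ k * y)).*2 + bindigit y k.+1)%N.
  by rewrite /bindigit exprS -mulrA -truncn_double// mulr_ge0// exprn_ge0.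
have E4 k : 4 ^+ k = 2 ^+ k.*2 :> R.
  by rewrite -mul2n exprM; congr (_ ^+ _); rewrite expr2 -natrM.
set p := digit_prefix y n in IH *; set b := bindigit y (e + n.*2.+1).
have -> : ((p.*2 + b)./2 = p)%N by case: (b); rewrite /=; lia.
have -> : odd (p.*2 + b) = b by case: (b); rewrite /=; lia.
apply/flattenP; eexists; first by apply: map_f IH.
rewrite !inE {1 2}E4 doubleS !step -!E4.
rewrite /b; have [->|->] : e = 0%N \/ e = 1%N by case: e e01 => [|[]]; auto.
  rewrite add0n /=; case: (bindigit y n.*2.+1);
    by case: (bindigit y n.*2.+2); rewrite /=; lia.
rewrite add1n /=; case: (bindigit y n.*2.+1);
  by case: (bindigit y n.*2.+2); rewrite /=; lia.
Qed.

Let cell n (m : nat) : set R := `[m%:R / 4 ^+ n, m.+1%:R / 4 ^+ n[%classic.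

Let measurable_cells n (L : seq nat) : measurable (\big[setU/set0]_(m <- L) cell n m).
Proof. by apply: bigsetU_measurable => m _; exact: measurable_itv. Qed.

Lemma measure_cells n (L : seq nat) :
  (mu (\big[setU/set0]_(m <- L) cell n m) <= ((size L)%:R / 4 ^+ n)%:E)%E.
Proof.
elim: L => [|m L IH]; first by rewrite big_nil measure0 mul0r.
rewrite big_cons; apply: le_trans (measureU2 _ _ _) _ => //=.
  exact: measurable_itv.
  exact: measurable_cells.
rewrite -[(size L).+1%:R]natr1 mulrDl EFinD addrC leeD//.
rewrite lebesgue_measure_itv/= lte_fin.
have p0 : 0 < (4 ^+ n)^-1 :> R by rewrite invr_gt0 exprn_gt0.
rewrite ltr_pM2r// ltr_nat leqnn -EFinB lee_fin -[m.+1%:R]natr1; lra.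
Qed.

Lemma measurable_bindigit k : measurable_fun (`[0, 1[%classic : set R)
  (fun y : R => (bindigit y k)%:R : R).
Proof.
have := @measurable_fun_discrete _ _ (measurableTypeR R) (measurableTypeR R) nat
  `[0, 1[%classic (fun y => Num.truncn (2 ^+ k * y)) (fun m _ => (odd m)%:R).
apply => [|m|m].
- exact: measurable_itv.
- rewrite (_ : _ `&` _ = `[0, 1[ `&` `[m%:R / 2 ^+ k, m.+1%:R / 2 ^+ k[)%classic.
    by apply: measurableI; exact: measurable_itv.
  have p0 : 0 < 2 ^+ k :> R by rewrite exprn_gt0.
  apply/seteqP; split => y /=; rewrite !in_itv/= => -[/andP[y0 y1]].
    move=> <-; split; first by rewrite y0.
    by rewrite ler_pdivrMr// ltr_pdivlMr// mulrC truncn_itv// mulr_ge0// ltW.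
  rewrite ler_pdivrMr// ltr_pdivlMr// mulrC => h; split; first by rewrite y0.
  exact: truncn_def.
- exact: measurable_cst.
Qed.

Lemma measurable_digit_limit : measurable_fun (`[0, 1[%classic : set R)
  (fun y : R => limn (digit_series y)).
Proof.
apply: (@measurable_fun_cvg _ _ _ _ (fun n y => digit_series y n)) => [n|y _].
  apply: measurable_sum => j; apply: measurable_funM; last exact: measurable_cst.
  exact: measurable_bindigit.
exact: is_cvg_digit_series.
Qed.

Let preim (A : set R) : set R :=
  `[0, 1[%classic `&` (fun y => limn (digit_series y)) @^-1` A.

(** At level [n] at most [2 ^+ n * (b - a) + 3] prefixes are compatible with a limit in the
    interval. Each prefix leaves [2 ^ n] cells of length [4 ^- n], so the preimage has measure at
    most [b - a + 3 / 2 ^+ n], and [n] is arbitrary. *)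
Lemma digit_limit_preimage_itv (a b : R) : a <= b ->
  (mu (preim `]a, b]%classic) <= (b - a)%:E)%E.
Proof.
move=> ab; set B := preim _.
have mB : measurable B.
  by apply: measurable_digit_limit => //; exact: measurable_itv.
suff H n : (mu B <= (b - a + 3 / 2 ^+ n)%:E)%E.
  apply/lee_addgt0Pr => eps eps0.
  have [n nE] : exists n, 3 / 2 ^+ n <= eps.
    exists (Num.truncn (3 / eps)).+1; rewrite ler_pdivrMr ?exprn_gt0//.
    rewrite -ler_pdivrMl// mulrC; apply: (@le_trans _ _ (Num.truncn (3 / eps)).+1%:R).
      by rewrite ltW// truncnS_gt.
    by rewrite -natrX ler_nat ltnW// ltn_expl.
  by apply: le_trans (H n) _; rewrite -EFinD lee_fin lerD2l.
have p0 : 0 < 2 ^+ n :> R by rewrite exprn_gt0.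
(* A prefix [P] of a limit in []a, b]] satisfies [2 ^+ n * a - 1 <= P <= 2 ^+ n * b]. The truncation
   [k0] is 0 when the lower bound is negative, and the 2 in [N] absorbs the slack of the lower bound
   and its rounding. *)
pose k0 := Num.truncn (2 ^+ n * a - 1); pose N := Num.truncn (2 ^+ n * (b - a) + 2).
pose L := flatten [seq cells n k | k <- iota k0 N.+1].
have szL : size L = (N.+1 * 2 ^ n)%N.
  rewrite /L -[in RHS](size_iota k0 N.+1); elim: (iota _ _) => //= k s IH.
  by rewrite size_cat IH size_cells mulSn.
apply: (@le_trans _ _ (mu (\big[setU/set0]_(m <- L) cell n m))).
  apply: le_measure; [by rewrite inE | by rewrite inE; exact: measurable_cells|].
  move=> y [/= + Jy]; rewrite in_itv/= => y01.
  have /andP[y0 y1] := y01.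
  move: Jy; rewrite in_itv/= => /andP[ay yb].
  have /andP[] := digit_limit_itv y n; set P := digit_prefix y n.
  rewrite ler_pdivrMr// ler_pdivlMr// -[P.+1%:R]natr1 => h1 h2.
  have Pb : P%:R <= 2 ^+ n * b.
    by rewrite mulrC; apply: le_trans h1 _; rewrite ler_pM2r.
  have Pa : 2 ^+ n * a <= P%:R + 1.
    by rewrite mulrC; apply: le_trans h2; rewrite ler_pM2r// ltW.
  have k0P : (k0 <= P)%N.
    by rewrite -(@natrK R P); apply: le_truncn; rewrite lerBlDr.
  have PN : (P <= k0 + N)%N.
    have k0gt : 2 ^+ n * a - 1 < k0.+1%:R by exact: truncnS_gt.
    rewrite -leq_subLR /N; rewrite truncn_ge_nat; last first.
      by rewrite addr_ge0// mulr_ge0 ?subr_ge0// ltW.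
    rewrite natrB// mulrBr; move: k0gt; rewrite -[k0.+1%:R]natr1; lra.
  rewrite -bigcup_seq; exists (Num.truncn (4 ^+ n * y)) => /=.
    apply/flattenP; exists (cells n P); last exact: truncn_cells.
    by apply: map_f; rewrite mem_iota k0P addnS ltnS.
  have q0 : 0 < 4 ^+ n :> R by rewrite exprn_gt0.
  rewrite /cell/= in_itv/= ler_pdivrMr// ltr_pdivlMr// mulrC truncn_itv//.
  by rewrite mulr_ge0// ltW.
apply: le_trans (measure_cells _ _) _; rewrite lee_fin szL.
have -> : 4 ^+ n = 2 ^+ n * 2 ^+ n :> R by rewrite -exprMn -natrM.
rewrite natrM natrX invfM mulrA mulfK ?gt_eqF// ler_pdivrMr// mulrDl divfK ?gt_eqF//.
have : N%:R <= 2 ^+ n * (b - a) + 2.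
  by rewrite truncn_le addr_ge0// mulr_ge0 ?subr_ge0// ltW.
rewrite -[N.+1%:R]natr1 mulrC; lra.
Qed.

(** A null set is covered by half-open intervals of arbitrarily small total length, and taking
    preimages of these intervals does not increase that total. *)
Lemma digit_limit_negligible (N : set R) : mu.-negligible N ->
  mu.-negligible (`[0, 1]%classic `&` (fun y => limn (digit_series y)) @^-1` N).
Proof.
move=> [M [mM M0 NM]]; 
(* The point 1 is set apart, because the digit estimates live on [[0, 1[]. *)
apply: (@negligibleS _ _ _ mu ([set 1] `|` preim M)).
  move=> y [/=]; rewrite !in_itv/= => /andP[y0].
  rewrite le_eqVlt => /orP[/eqP-> _|y1 fN].
    by left.
  by right; split; [rewrite /= in_itv/= y0 | exact: NM].
apply: negligibleU; first by apply/negligibleP => //; exact: lebesgue_measure_set1.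
have mf B : measurable B -> measurable (preim B).
  by move=> mB; apply: measurable_digit_limit => //; exact: measurable_itv.
apply/negligibleP; first exact: mf.
apply/eqP; rewrite -measure_le0; apply/lee_addgt0Pr => eps eps0; rewrite add0e.
(* Lebesgue measure unfolds to an infimum over countable covers by half-open intervals; [F] is a
   cover of total length below [eps]. *)
have : (lebesgue_measure M < eps%:E)%E by rewrite M0 lte_fin.
move=> /ereal_inf_lt[_ [F [mF MF] <-] Feps]; apply: le_trans (ltW Feps).
have FE k : exists2 ab : R * R, ab.1 <= ab.2 & F k = `]ab.1, ab.2]%classic.
  have /ocitvP[->|[ab lab ->]] : ocitv (F k) by exact: mF.
    by exists (0, 0) => //=; rewrite set_itvoc0.
  by exists ab; [exact: ltW|].
apply: le_trans (@measure_sigma_subadditive _ _ _ mu _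
  (fun k => preim (F k)) _ _ _) _.
- by move=> k; apply: mf; have [ab _ ->] := FE k; exact: measurable_itv.
- exact: mf.
- by move=> y [y01 /MF[k _ Fk]]; exists k.
apply: lee_nneseries => // k _; have [ab lab ->] := FE k.
apply: le_trans (digit_limit_preimage_itv lab) _.
rewrite /= [X in (_ <= X)%E](_ : _ = wlength idfun `]ab.1, ab.2]%classic)//.
by rewrite wlength_itv/= lte_fin; case: ltP => [_|ba]; rewrite ?EFinB// lee_fin; lra.
Qed.

End BinaryDigits.

(** * Integrals and sums *)

(* No measurability is needed: the integral of a nonnegative function is a
   supremum over the simple functions below it. *)
Lemma le_integral_nonmeasurable d (T : measurableType d) (R : realType)
    (mu : {measure set T -> \bar R}) (D : set T) (f g : T -> \bar R) :
  (forall x, D x -> 0 <= f x)%E -> (forall x, D x -> f x <= g x)%E ->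
  (\int[mu]_(x in D) f x <= \int[mu]_(x in D) g x)%E.
Proof.
move=> f0 fg; have g0 x : D x -> (0 <= g x)%E.
  by move=> Dx; exact: le_trans (f0 x Dx) (fg x Dx).
rewrite !ge0_integralE//; apply: ge_ereal_sup => _ [h hf <-].
apply: ereal_sup_ubound; exists h => //= x; apply: le_trans (hf x) _.
by rewrite /patch; case: ifPn => // /[!inE]; exact: fg.
Qed.

Section UnitInterval.
Context (R : realType).
Local Notation mu := (@lebesgue_measure R).
Local Notation D := (`[0%R, 1%R]%classic : set R).

Lemma integral_unit_cst (c : \bar R) : (\int[mu]_(y in D) c = c)%E.
Proof.
have := @integral_cst _ _ R mu D (measurable_itv _) c.
by rewrite /= lebesgue_measure_itv/= lte_fin ltr01 oppr0 addr0 mule1.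
Qed.

(** Lowering the constant [K] to 0 on a measurable null set that contains [N] gives a measurable
    minorant of [f] whose integral is still [K]. *)
Lemma integral_unit_ge (f : R -> \bar R) (K : \bar R) (N : set R) : (0 <= K)%E ->
  (forall y, D y -> 0 <= f y)%E -> mu.-negligible N ->
  (forall y, D y -> ~ N y -> K <= f y)%E -> (K <= \int[mu]_(y in D) f y)%E.
Proof.
move=> K0 f0 [M [mM M0 NM]] Kf.
have mD : measurable D by exact: measurable_itv.
apply: (@le_trans _ _ (\int[mu]_(y in D) (if y \in M then 0 else K))%E).
  rewrite -[leLHS]integral_unit_cst le_eqVlt; apply/orP; left; apply/eqP.
  apply: ge0_ae_eq_integral => //.
  - apply: measurable_fun_if => //; [|exact: measurable_cst..].
    by apply: (measurable_fun_bool true); rewrite preimage_mem_true; exact: measurableI.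
  - by move=> y _; case: ifP.
  - exists M; split => // y /= nP; apply: contrapT => nM; apply: nP => _.
    by rewrite ifF//; apply: memNset.
apply: le_integral_nonmeasurable => y Dy; first by case: ifP.
by case: ifPn => [_|/negP]; [exact: f0 | rewrite inE => nM; apply: Kf => // /NM].
Qed.

End UnitInterval.

(** * Sums over countable types, exchange with integrals, and point masses *)

Section Esum.
Context (R : realType).

Lemma esumZl (X : choiceType) (c : R) (f : X -> \bar R) : 0 <= c ->
  (forall x, 0 <= f x)%E ->
  (\esum_(x in [set: X]) (c%:E * f x) = c%:E * \esum_(x in [set: X]) f x)%E.
Proof.
move=> c0 f0; rewrite /esum -ereal_supZl//; last first.
  by apply/set0P; exists 0%E, set0; [exact: fsets_set0 | rewrite fsbig_set0].
rewrite image_comp; congr ereal_sup; apply: eq_imagel => A _ /=.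
by rewrite -ge0_mule_fsumr.
Qed.

Lemma esum_fintype (X : finType) (f : X -> \bar R) : (forall x, 0 <= f x)%E ->
  (\esum_(x in [set: X]) f x = \sum_x f x)%E.
Proof.
move=> f0; rewrite esum_fset//; last exact: finite_finset.
rewrite (_ : [set: X] = [set` enum X]).
  by rewrite -fsbig_seq ?enum_uniq// big_enum.
by apply/seteqP; split => x //= _; rewrite mem_enum.
Qed.

(** Enumerating [X] by [pickle], with 0 at indices that code no element, turns the sum into a
    series, to which term-by-term integration applies. *)
Lemma esum_nneseries (X : countType) (f : X -> \bar R) : (forall x, 0 <= f x)%E ->
  (\esum_(x in [set: X]) f x = \sum_(i <oo) oapp f 0 (pickle_inv i))%E.
Proof.
move=> f0; set F := fun i => oapp f 0%E (pickle_inv i).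
have F0 i : (0 <= F i)%E by rewrite /F; case: pickle_inv.
rewrite nneseries_esumT// (esumID (range (@pickle X))); last by move=> i _; exact: F0.
rewrite !setTI.
rewrite [X in (_ + X)%E]esum1 ?adde0.
  rewrite (reindex_esum [set: X] (range pickle) pickle F).
    by apply: eq_esum => x _; rewrite /F pickleK_inv.
  split => [x _|x y _ _|_ [x _ <-]]; [by exists x| |by exists x].
  by move/(congr1 (@pickle_inv X)); rewrite !pickleK_inv => -[].
move=> i /= ni; rewrite /F; have := @pickle_invK X i.
by case: pickle_inv => //= x xi; exfalso; apply: ni; exists x.
Qed.

Lemma integral_esum d (T : measurableType d) (m : {measure set T -> \bar R})
    (D : set T) (X : countType) (f : X -> T -> \bar R) : measurable D ->
  (forall x, measurable_fun D (f x)) -> (forall x t, D t -> 0 <= f x t)%E ->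
  (\int[m]_(t in D) (\esum_(x in [set: X]) f x t) =
   \esum_(x in [set: X]) \int[m]_(t in D) f x t)%E.
Proof.
move=> mD mf f0.
rewrite esum_nneseries; last by move=> x; exact: integral_ge0 (f0 x).
transitivity (\int[m]_(t in D) (\sum_(i <oo) oapp (f ^~ t) 0 (pickle_inv i)))%E.
  apply: eq_integral => t /[!inE] Dt; rewrite esum_nneseries// => x; exact: f0.
rewrite integral_nneseries//; last 2 first.
- by move=> i; case: pickle_inv => [x|] /=; [exact: mf | exact: measurable_cst].
- by move=> i t Dt; case: pickle_inv => [x|] //=; exact: f0.
by apply: eq_eseriesr => i _; case: pickle_inv => //=; rewrite integral0.
Qed.

Definition dirac_pmf (X : choiceType) (a x : X) : R := (x == a)%:R.

Lemma esum_dirac (X : choiceType) (a : X) (f : X -> R) : 0 <= f a ->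
  (\esum_(x in [set: X]) (dirac_pmf a x * f x)%:E = (f a)%:E)%E.
Proof.
move=> fa0; rewrite -(@esum_set1 _ _ a (fun x => (f x)%:E))//.
rewrite [RHS]esum_mkcond; apply: eq_esum => x _; rewrite /dirac_pmf.
have [->|xa] := eqVneq x a; first by rewrite mul1r mem_set.
by rewrite mul0r memNset//=; apply/eqP.
Qed.

Lemma dirac_is_pmf (X : choiceType) (a : X) : is_pmf (dirac_pmf a).
Proof.
split=> [x|]; first by rewrite /dirac_pmf ler0n.
by rewrite -(esum_dirac (a := a) (f := fun=> 1))//; apply: eq_esum => x _; rewrite mulr1.
Qed.

Lemma esum_pmfZ (X : choiceType) (p : X -> R) (c : R) : is_pmf p -> 0 <= c ->
  (\esum_(x in [set: X]) (p x * c)%:E = c%:E)%E.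
Proof.
move=> [p0 p1] c0; rewrite -[RHS]mule1 -p1 -esumZl//.
by apply: eq_esum => x _; rewrite mulrC EFinM.
Qed.

End Esum.

(** * Steering *)

Section Oscillation.
Context (R : realType) (S A : countType) (YS YR : finType).
Variables (q : YR -> R) (I : mdp R S A YS YR).
Hypotheses (YS_gt0 : (0 < #|YS|)%N) (q_pmf : is_pmf q).
Local Notation mu := (@lebesgue_measure R).
Local Notation D := (`[0%R, 1%R]%classic : set R).
Implicit Types (pi : policy R S A) (rew : nat -> A -> S -> R).

Definition slice pi (y : R) : nat -> S -> A := fun t s => pi t s y.

Lemma sum_pmf : \sum_z q z = 1.
Proof.
have [q0 q1] := q_pmf; apply: EFin_inj; rewrite -q1 esum_fintype ?sumEFin//.
Qed.

Lemma mean_reward_bd rb t a s : rewards_in I rb -> (t < horizon I)%N ->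
  0 <= mean_reward q I t a s <= rb.
Proof.
move=> bd tT; have [q0 _] := q_pmf; apply/andP; split.
  apply: sumr_ge0 => z _; apply: mulr_ge0 => //.
  by have /andP[] := bd t a s z tT.
rewrite -[rb]mul1r -sum_pmf mulr_suml; apply: ler_sum => z _.
by apply: ler_wpM2l => //; have /andP[] := bd t a s z tT.
Qed.

Lemma measurable_pval pi rew n u g s : admissible pi ->
  measurable_fun D (fun y => pval (trans I) rew (slice pi y) n u g s).
Proof.
move=> api; elim: n u s => [|n IH] u s /=; first exact: measurable_cst.
have := @measurable_fun_discrete _ _ (measurableTypeR R) (measurableTypeR R) A
  D (fun y => pi u s y)
  (fun a y => qval (trans I) rew u a (pval (trans I) rew (slice pi y) n u.+1 g) s).
apply => [|a|a]; first exact: measurable_itv.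
  exact: api.
apply: measurable_funD; first exact: measurable_cst.
apply: measurable_funM; first exact: measurable_cst.
by apply: measurable_sum => z; exact: IH.
Qed.

Local Notation prob := (pval (trans I) (fun _ _ _ => 0)).

Lemma prob_bd d n u x s : 0 <= prob d n u (dirac_pmf R x) s <= 1.
Proof.
(* Read as a policy that ignores [y], [d] makes [prob] an average over noise tuples of a 0-1
   indicator. *)
have := @tavg_run_final _ _ _ _ _ I (fun t s _ => d t s) 0 n u (dirac_pmf R x) s.
rewrite /= => <-; have [p0 _] := dirac_is_pmf R x.
apply/andP; split.
  by apply: sumr_ge0 => ys _; rewrite mulr_ge0// exprn_ge0// invr_ge0 ler0n.
rewrite -[leRHS](@tavg_cst R YS n 1 YS_gt0); apply: ler_sum => ys _.
apply: ler_wpM2l; first by rewrite exprn_ge0// invr_ge0 ler0n.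
by rewrite /dirac_pmf; case: eqP.
Qed.

Lemma esum_prob d n u s :
  (\esum_(x in [set: S]) (prob d n u (dirac_pmf R x) s)%:E = 1)%E.
Proof.
elim: n u s => [|n IH] u s /=.
  rewrite -(esum_dirac (a := s) (f := fun=> 1))//; apply: eq_esum => x _.
  by rewrite mulr1 /dirac_pmf eq_sym.
transitivity (\esum_(x in [set: S]) \sum_z (#|YS|%:R^-1%:E *
  (prob d n u.+1 (dirac_pmf R x) (trans I u (d u s) s z))%:E))%E.
  apply: eq_esum => x _; rewrite /qval add0r /avg mulr_sumr -sumEFin.
  by apply: eq_bigr => z _; rewrite EFinM.
rewrite esum_sum; last first.
  move=> x z _ _; rewrite -EFinM lee_fin mulr_ge0 ?invr_ge0 ?ler0n//.
  by have /andP[] := prob_bd d n u.+1 x (trans I u (d u s) s z).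
under eq_bigr => z _.
  rewrite esumZl ?invr_ge0 ?ler0n//; last first.
    move=> x; rewrite lee_fin.
    by case/andP: (prob_bd d n u.+1 x (trans I u (d u s) s z)).
  rewrite IH mule1; over.
rewrite sumEFin; congr EFin; have := avg_cst (1 : R) YS_gt0.
by rewrite /avg mulr_sumr => {2}<-; apply: eq_bigr => z _; rewrite mulr1.
Qed.

Definition reach_prob pi t0 s t x : \bar R :=
  (\int[mu]_(y in D) (prob (slice pi y) t t0 (dirac_pmf R x) s)%:E)%E.

Lemma reach_prob_bd pi t0 s t x : (0 <= reach_prob pi t0 s t x <= 1)%E.
Proof.
apply/andP; split.
  apply: integral_ge0 => y _; rewrite lee_fin.
  by case/andP: (prob_bd (slice pi y) t t0 x s).
apply: (@le_trans _ _ (\int[mu]_(y in D) 1)%E); last by rewrite integral_unit_cst.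
apply: le_integral_nonmeasurable => y _.
  by rewrite lee_fin; case/andP: (prob_bd (slice pi y) t t0 x s).
by rewrite lee_fin; case/andP: (prob_bd (slice pi y) t t0 x s).
Qed.

(** The integral under [fine] lies in [[0, 1]], so passing to a real number loses nothing. *)
Lemma state_law_dirac pi t0 s t x :
  (state_law I pi t0 (dirac_pmf R s) t x)%:E = reach_prob pi t0 s t x.
Proof.
rewrite state_lawE; rewrite (_ : (\int[_]_(_ in _) _)%E = reach_prob pi t0 s t x).
  rewrite fineK// fin_numElt; have /andP[l u] := reach_prob_bd pi t0 s t x.
  by rewrite (lt_le_trans _ l)// (le_lt_trans u)// ltry.
apply: eq_integral => y _.
have := @esum_dirac R S s (fun s => prob (slice pi y) t t0 (dirac_pmf R x) s).
by move=> <-//; case/andP: (prob_bd (slice pi y) t t0 x s).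
Qed.

Lemma esum_reach_prob pi t0 s t : admissible pi ->
  (\esum_(x in [set: S]) reach_prob pi t0 s t x = 1)%E.
Proof.
move=> api; rewrite -integral_esum.
- rewrite -[RHS](@integral_unit_cst R 1%E); apply: eq_integral => y _.
  exact: esum_prob.
- exact: measurable_itv.
- by move=> x; apply/measurable_EFinP; exact: measurable_pval.
- by move=> x y _; rewrite lee_fin; case/andP: (prob_bd (slice pi y) t t0 x s).
Qed.

(* With a Dirac target, the total variation distance is the probability of
   missing the target. *)
Lemma steer eps tau t0 s x : within_diameter I eps tau ->
  (t0 < horizon I - tau)%N ->
  exists2 pi, admissible pi & ((1 - eps)%:E <= reach_prob pi t0 s tau x)%E.
Proof.
move=> wd t0T.
have [_ [pi [api tv]]] := wd _ _ (dirac_is_pmf R s) (dirac_is_pmf R x) t0 t0T.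
exists pi => //; move: tv; rewrite /tv_dist.
set p := state_law I pi t0 (dirac_pmf R s) tau.
have pE z : (p z)%:E = reach_prob pi t0 s tau z by exact: state_law_dirac.
have p01 z : 0 <= p z <= 1.
  by have := reach_prob_bd pi t0 s tau z; rewrite -pE !lee_fin.
have p0 z : 0 <= p z by case/andP: (p01 z).
have := esum_reach_prob t0 s tau api.
rewrite (esumID [set x]); last by move=> z _; rewrite -pE lee_fin.
rewrite (esumID [set x] _ (fun z => (`|_|)%:E)); last by move=> z _; rewrite lee_fin.
rewrite !setTI !esum_set1 -?pE ?lee_fin//.
set E1 := \esum_(_ in _) _; set E2 := \esum_(_ in _) _.
(* Away from [x] the target has no mass, so both sums agree there, and total mass 1 gives
   [E1 = 1 - p x]. The term at [x] is [1 - p x] too, and the factor one half leaves exactly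
   [1 - p x]. *)
have -> : E2 = E1.
  apply: eq_esum => z /= /eqP zx; rewrite -pE /dirac_pmf (negbTE zx) subr0.
  by rewrite ger0_norm.
have [_ p1] := andP (p01 x).
rewrite /dirac_pmf eqxx ler0_norm ?subr_le0// opprB.
case: E1 => [r| |] //=; rewrite -EFinD => -[pr].
by rewrite -EFinD -EFinM !lee_fin; lra.
Qed.

End Oscillation.

(** * Oscillation of the Bellman value and slices of optimal policies *)

Section Regret.
Context (R : realType) (S A : countType) (YS YR : finType).
Variables (q : YR -> R) (rb : R) (a0 : A).
Hypotheses (YS_gt0 : (0 < #|YS|)%N) (q_pmf : is_pmf q) (rb_ge0 : 0 <= rb).
Local Notation mu := (@lebesgue_measure R).
Local Notation D := (`[0%R, 1%R]%classic : set R).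
Implicit Types (I : mdp R S A YS YR) (pi : policy R S A).

Lemma eps_diameterP I eps : within_diameter I eps (eps_diameter I eps).
Proof. by rewrite /eps_diameter; case: ex_minnP => t /asboolP. Qed.

Local Notation opt I n u := (oval (trans I) (mean_reward q I) n u (fun=> 0)).

Lemma opt_bd I n u s : rewards_in I rb -> (u + n <= horizon I)%N ->
  0 <= opt I n u s <= rb * n%:R.
Proof.
move=> Ird unT; rewrite -[rb * _]addr0.

apply: (oval_bd _ YS_gt0 a0 (T := horizon I)) => // [t a x tT|_].
  exact: mean_reward_bd.
by rewrite lexx.
Qed.

Lemma opt_oscillation I eps tau n u s s' : rewards_in I rb -> 0 <= eps < 1 ->
  within_diameter I eps tau -> (u + n = horizon I)%N ->
  opt I n u s' <= opt I n u s + rb * tau%:R / (1 - eps).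
Proof.
move=> Ird /andP[e0 e1] wd.
have Id t a x : (t < horizon I)%N -> 0 <= mean_reward q I t a x <= rb.
  exact: mean_reward_bd.
set C := rb * _ / _.
have CE : C = rb * tau%:R + eps * C by rewrite /C; field; lra.
have C0 : 0 <= C by rewrite divr_ge0 ?mulr_ge0//; lra.
elim/ltn_ind: n u s s' => n IH u s s' unT.
(* With at most [tau] stages left the whole value is at most [rb * tau%:R], which is below [C]. *)
have [ntau|taun] := leqP n tau.
  have /andP[w0 _] := opt_bd s Ird (eq_leq unT).
  have /andP[_ w1] := opt_bd s' Ird (eq_leq unT).
  have : rb * n%:R <= rb * tau%:R by rewrite ler_wpM2l// ler_nat.
  have : 0 <= eps * C by rewrite mulr_ge0.
  lra.
have ut : (u < horizon I - tau)%N by lia.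
(* For [tau = 0] the induction would not descend, but then no move takes place, and hitting any
   state with probability at least [1 - eps > 0] forces a single state. *)
case: (posnP tau) => [tau0|tau_gt0].
  suff -> : s = s' by rewrite lerDl.
  have [pi api] := steer YS_gt0 s s' wd ut.
  rewrite /reach_prob tau0 /= integral_unit_cst lee_fin /dirac_pmf.
  by have [//|_] := eqVneq s s' => /= h; exfalso; lra.
set m := (n - tau)%N; have nE : n = (tau + m)%N by lia.
pose g := opt I m (u + tau)%N.
have utT : (u + tau + m <= horizon I)%N by lia.
have W x : opt I n u x = oval (trans I) (mean_reward q I) tau u g x.
  by rewrite nE oval_add.
have gosc x x' : g x <= g x' + C by apply: IH; lia.
have gbd x : 0 <= g x <= rb * m%:R by exact: opt_bd.
have reach x : g x <= opt I n u s + eps * C.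
  have [pi api] := steer YS_gt0 s x wd ut.
  set p := reach_prob I pi u s tau x => pe.
  (* By induction [g] is at least [g x - C] everywhere and equals [g x] at [x]; the rewards
     collected while steering are dropped as nonnegative. *)
  have Wy y : g x - C + C * pval (trans I) (fun _ _ _ => 0) (slice pi y) tau u
      (dirac_pmf R x) s <= opt I n u s.
    rewrite -pval0_affine// W.
    apply: le_trans (pval_le_oval _ YS_gt0 a0 Id (slice pi y) s _ gbd); last by lia.
    apply: le_pval => [t a z tu|z].
      have tT : (t < horizon I)%N by lia.
      by have /andP[] := Id t a z tT.
    rewrite /dirac_pmf; case: eqP => [->|_]; first by rewrite mulr1 subrK.
    by rewrite mulr0 addr0 lerBlDr.
  have [C_eq0|C_neq0] := eqVneq C 0.
    by have := Wy 0; rewrite C_eq0 mulr0 mul0r subr0 !addr0.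
  have C_gt0 : 0 < C by rewrite lt_neqAle eq_sym C_neq0.
  (* The bound [Wy] holds slice by slice; solved for the hitting probability, which needs [C > 0],
     it is integrated over [y]. With [1 - eps <= p] it gives [reach]. *)
  have : (p <= ((opt I n u s - g x + C) / C)%:E)%E.
    rewrite -[leRHS](@integral_unit_cst R).
    apply: le_integral_nonmeasurable => y _; rewrite lee_fin.
      by have /andP[] := prob_bd I YS_gt0 (slice pi y) tau u x s.
    by rewrite ler_pdivlMr// mulrC; have := Wy y; lra.
  move=> /(le_trans pe); rewrite lee_fin ler_pdivlMr//.
  by rewrite mulrBl mul1r; lra.
(* From [s'], the first [tau] stages earn at most [rb * tau%:R] and the rest at most the upper bound
   on [g]; [CE] turns the total into [C]. *)
rewrite [leLHS]W; have gM x : 0 <= g x <= opt I n u s + eps * C.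
  by rewrite reach; have /andP[->] := gbd x.
have utT' : (u + tau <= horizon I)%N by lia.
have /andP[_] := oval_bd (trans I) YS_gt0 a0 Id s' utT' gM; lra.
Qed.

(** Starting from a point mass at [s], the slice values never exceed the Bellman value but integrate
    to at least it, so they agree for almost every [y]. Countability of [S] then gives one null set
    for all states. *)
Lemma optimal_slice_ae I pi : rewards_in I rb -> optimal q I pi ->
  mu.-negligible [set y | D y /\ exists s, pval (trans I) (mean_reward q I)
    (slice pi y) (horizon I) 0 (fun=> 0) s != opt I (horizon I) 0 s].
Proof.
move=> Ird [api piopt].
have Id t a x : (t < horizon I)%N -> 0 <= mean_reward q I t a x <= rb.
  exact: mean_reward_bd.
pose v y s := pval (trans I) (mean_reward q I) (slice pi y) (horizon I) 0 (fun=> 0) s.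
pose w s := opt I (horizon I) 0 s.
have z01 (s : S) : 0 <= (0 : R) <= 0 by rewrite lexx.
have v0 y s : 0 <= v y s by apply: (pval_ge0 _ YS_gt0 Id).
have vw y s : v y s <= w s by apply: (pval_le_oval _ YS_gt0 a0 Id _ _ _ z01).
suff H s : mu.-negligible [set y | D y /\ v y s != w s].
  pose F i := oapp (fun s => [set y | D y /\ v y s != w s]) set0 (pickle_inv i).
  apply: (@negligibleS _ _ _ mu (\bigcup_i F i)).
    by move=> y [Dy [s vs]]; exists (pickle s) => //=; rewrite /F pickleK_inv.
  apply: negligible_bigcup => i; rewrite /F.
  by case: pickle_inv => [s|] /=; [exact: H | exact: negligible_set0].
have mD : measurable D by exact: measurable_itv.
have mv : measurable_fun D (fun y => v y s) by exact: measurable_pval.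
have valE pi' : value q I pi' (dirac_pmf R s) = (\int[mu]_(y in D)
    (pval (trans I) (mean_reward q I) (slice pi' y) (horizon I) 0 (fun=> 0) s)%:E)%E.
  rewrite valueE ?sum_pmf//; apply: eq_integral => y _.
  by rewrite -esum_dirac//; apply: (pval_ge0 _ YS_gt0 Id).
have w_le : ((w s)%:E <= \int[mu]_(y in D) (v y s)%:E)%E.
  rewrite -valE; apply/lee_addgt0Pr => e e0.
  (* The Bellman value need not be attained, so [pi] is compared with a deterministic policy that
     loses at most [delta] per stage. The successor in the denominator covers horizon 0. *)
  pose delta := e / (horizon I).+1%:R.
  have delta0 : 0 < delta by rewrite divr_gt0.
  have [d dP] := near_optimal (trans I) YS_gt0 a0 Id delta0 z01.
  have ad : admissible (fun t s (_ : R) => d t s).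
    move=> t x B; rewrite preimage_cst; case: ifP => _; rewrite ?setIT ?setI0//.
  apply: le_trans (leeD (piopt _ (dirac_is_pmf R s) _ ad) (lexx _)).
  rewrite valE /slice integral_unit_cst -EFinD lee_fin.
  have := dP (horizon I) 0%N s (add0n _); rewrite -/(w s).
  have : delta * (horizon I)%:R <= e.
    by rewrite /delta mulrAC ler_pdivrMr// ler_pM2l// ler_nat.
  by move=> h1 h2; apply: le_trans (lerD h2 h1); rewrite subrK.
(* The gap [w s - v y s] is nonnegative; since the integral of [v] is finite, it can be cancelled,
   so the gap integrates to 0 and vanishes almost everywhere. *)
have wv0 : (\int[mu]_(y in D) `|(w s - v y s)%:E| = 0)%E.
  have mwv : measurable_fun D (fun y => (w s - v y s)%:E).
    by apply/measurable_EFinP; apply: measurable_funB => //; exact: measurable_cst.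
  have wv_ge0 y : (0 <= (w s - v y s)%:E)%E by rewrite lee_fin subr_ge0.
  have -> : (\int[mu]_(y in D) `|(w s - v y s)%:E| =
             \int[mu]_(y in D) (w s - v y s)%:E)%E.
    by apply: eq_integral => y _; rewrite gee0_abs.
  apply/eqP; rewrite eq_le integral_ge0// andbT.
  have vfin : (\int[mu]_(y in D) (v y s)%:E <= (w s)%:E)%E.
    rewrite -[leRHS](@integral_unit_cst R); apply: le_integral_nonmeasurable => y _;
      by rewrite lee_fin.
  have /fineK vE : (\int[mu]_(y in D) (v y s)%:E)%E \is a fin_num.
    by rewrite fin_numElt (lt_le_trans _ w_le) ?ltNyr// (le_lt_trans vfin)// ltry.
  have : (\int[mu]_(y in D) ((w s - v y s)%:E + (v y s)%:E) = (w s)%:E)%E.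
    rewrite -[RHS](@integral_unit_cst R); apply: eq_integral => y _.
    by rewrite -EFinD subrK.
  rewrite ge0_integralD//; last 2 first.
  - by move=> y _; rewrite lee_fin.
  - exact/measurable_EFinP.
  move=> sumE; have := w_le; rewrite -{1}sumE -vE.
  by rewrite -[X in (_ <= X)%E -> _]add0e leeD2rE.
have mwv : measurable_fun D (fun y => (w s - v y s)%:E).
  by apply/measurable_EFinP; apply: measurable_funB => //; exact: measurable_cst.
have [N [mN N0 sN]] := (ae_eq_integral_abs mu mD mwv).1 wv0.
exists N; split => // y [Dy vy]; apply: sN => /= /(_ Dy) [] h.
by move: vy; rewrite eq_sym -subr_eq0 h eqxx.
Qed.

End Regret.

(** * Regret of temporal concatenation *)

(** An empty sum cannot equal 1. The state obtained here also yields an action, by applying a policy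
    to it. *)
Lemma pmf_inhabited (R : realType) (X : choiceType) (p : X -> R) :
  is_pmf p -> exists x : X, True.
Proof.
move=> [_ p1]; apply: contrapT => nX; have /eqP := p1.
rewrite esum1 ?(eq_sym 0%E) ?onee_eq0// => x _.
by exfalso; apply: nX; exists x.
Qed.

Lemma digit_limit_unit (R : realType) e (y : R) :
  0 <= limn (digit_series e y) <= 1.
Proof. by have := digit_limit_itv e y 0; rewrite expr0 !divr1. Qed.

Section TemporalConcatenation.
Context (R : realType) (S A : countType) (YS YR : finType).
Variables (q : YR -> R) (rb : R) (I : mdp R S A YS YR) (a0 : A).
Hypotheses (YS_gt0 : (0 < #|YS|)%N) (q_pmf : is_pmf q) (rb_ge0 : 0 <= rb).
Hypotheses (Ird : rewards_in I rb) (T_even : ~~ odd (horizon I)).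
Local Notation mu := (@lebesgue_measure R).
Local Notation D := (`[0%R, 1%R]%classic : set R).
Local Notation h := (horizon I)./2.
Local Notation rew := (mean_reward q I).

Let horizonE : horizon I = (h + h)%N.
Proof. by rewrite addnn even_halfK. Qed.

Let rew_bd t a s : (t < horizon I)%N -> 0 <= rew t a s <= rb.
Proof. exact: mean_reward_bd. Qed.

Let rewards_first_half : rewards_in (first_half I) rb.
Proof. by move=> t a s z /= th; apply: Ird; lia. Qed.

Let rewards_second_half : rewards_in (second_half I) rb.
Proof. by move=> t a s z /= th; apply: Ird; lia. Qed.

Let W1 s := oval (trans I) rew h 0 (fun=> 0) s.
Let W2 s := oval (trans I) rew h h (fun=> 0) s.

Let W1_bd s : 0 <= W1 s <= rb * h%:R.
Proof. by apply: (opt_bd a0) => //; lia. Qed.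

Let W2_bd s : 0 <= W2 s <= rb * h%:R.
Proof. by apply: (opt_bd a0) => //; lia. Qed.

Let pvalE d s : pval (trans I) rew d (horizon I) 0 (fun=> 0) s =
  pval (trans I) rew d h 0 (pval (trans I) rew d h h (fun=> 0)) s.
Proof. by rewrite {1}horizonE pval_add add0n. Qed.

(** Replacing the second-half payoff by the constant [C] decouples the halves: the constant comes
    out of the recursion, and a first-half evaluation remains. *)
Lemma pval_le_split d C s : (forall x, W2 x <= C) ->
  pval (trans I) rew d (horizon I) 0 (fun=> 0) s <= W1 s + C.
Proof.
move=> WC; have z0 (x : S) : 0 <= (0 : R) <= 0 by rewrite lexx.
rewrite pvalE; apply: (@le_trans _ _ (pval (trans I) rew d h 0 (fun=> 0 + C) s)).
  apply: le_pval => [//|x]; rewrite add0r; apply: le_trans (WC x).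
  by apply: (pval_le_oval _ YS_gt0 a0 rew_bd _ _ _ z0); lia.
rewrite pvalDc// lerD2r.
by apply: (pval_le_oval _ YS_gt0 a0 rew_bd _ _ _ z0); lia.
Qed.

(** The exceptional [y] are those whose odd digits form a bad slice of [pi1] or whose even digits
    form a bad slice of [pi2]. Outside them both halves attain their Bellman values. *)
Lemma temporal_concat_ae pi1 pi2 c :
  optimal q (first_half I) pi1 -> optimal q (second_half I) pi2 ->
  (forall x, c <= W2 x) ->
  exists2 N, mu.-negligible N & forall y, D y -> ~ N y -> forall s,
    W1 s + c <= pval (trans I) rew
      (slice (temporal_concat (horizon I) pi1 pi2) y) (horizon I) 0 (fun=> 0) s.
Proof.
move=> o1 o2 cW.
have N1 := optimal_slice_ae a0 YS_gt0 q_pmf rewards_first_half o1.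
have N2 := optimal_slice_ae a0 YS_gt0 q_pmf rewards_second_half o2.
have M1 := digit_limit_negligible (isT : (0 <= 1)%N) N1.
have M2 := digit_limit_negligible (isT : (1 <= 1)%N) N2.
refine (ex_intro2 _ _ _ (negligibleU M1 M2) _).
move=> y Dy nN s; rewrite pvalE.
set d := slice _ y.
have E1 x : pval (trans I) rew d h 0 (fun=> 0) x = W1 x.
  apply/eqP/negP => ne; apply: nN; left; split => //=; split.
    by rewrite in_itv/=; exact: digit_limit_unit.
  exists x; apply/negP => /eqP eq; apply: ne; apply/eqP; apply: etrans eq.
  by apply: eq_pval => t z /andP[_ th]; rewrite /d /slice /temporal_concat th.
have E2 x : pval (trans I) rew d h h (fun=> 0) x = W2 x.
  apply/eqP/negP => ne; apply: nN; right; split => //=; split.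
    by rewrite in_itv/=; exact: digit_limit_unit.
  exists x; apply/negP => /eqP eq; apply: ne; apply/eqP.
  (* The clock of [second_half I] restarts at 0, so the starting time is written [h + 0] to match
     the shift lemmas. *)
  have shift0 : (h + 0)%N = h by rewrite addn0.
  rewrite /W2 -{2 4}shift0 -pval_shift -oval_shift; apply: etrans eq.
  apply: eq_pval => t z _; rewrite /d /slice /temporal_concat.
  by rewrite ltnNge leq_addr/= addKn.
apply: (@le_trans _ _ (pval (trans I) rew d h 0 (fun=> 0 + c) s)).
  by rewrite pvalDc// E1.
by apply: le_pval => [//|x]; rewrite add0r E2.
Qed.

Lemma regret_le piopt pi1 pi2 mu0 eps tau :
  0 <= eps < 1 -> within_diameter I eps tau -> is_pmf mu0 ->
  optimal q (first_half I) pi1 -> optimal q (second_half I) pi2 ->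
  (regret q I piopt pi1 pi2 mu0 <= (rb * tau%:R / (1 - eps))%:E)%E.
Proof.
move=> eps01 wd pmf0 o1 o2; have [s0 _] := pmf_inhabited pmf0.
have /andP[eps0 eps1] := eps01.
set C := rb * _ / _.
have C0 : 0 <= C by rewrite divr_ge0 ?mulr_ge0//; lra.
have osc x x' : W2 x' <= W2 x + C.
  by apply: (opt_oscillation a0) => //; rewrite -horizonE.
pose c := inf (range W2).
have hasinf : has_inf (range W2).
  split; first by exists (W2 s0), s0.
  by exists 0 => _ [x _ <-]; have /andP[] := W2_bd x.
have c0 : 0 <= c.
  apply: lb_le_inf; first by exists (W2 s0), s0.
  by move=> _ [x _ <-]; have /andP[] := W2_bd x.
have cW x : c <= W2 x by apply: ge_inf; [exact: hasinf.2 | exists x].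
have Wc x : W2 x <= c + C.
  rewrite -lerBlDr; apply: lb_le_inf; first by exists (W2 s0), s0.
  by move=> _ [x' _ <-]; rewrite lerBlDr.
have [m0 m1] := pmf0.
have Wc0 s : 0 <= W1 s + c by rewrite addr_ge0//; have /andP[] := W1_bd s.
(* [K] is the pivot: the optimal value is at most [K + C] and the concatenated policy earns at least
   [K]. Its finiteness allows it to cancel in the regret. *)
pose K := (\esum_(s in [set: S]) (mu0 s * (W1 s + c))%:E)%E.
have K0 : (0 <= K)%E by apply: esum_ge0 => s _; rewrite lee_fin mulr_ge0.
have Kfin : K \is a fin_num.
  rewrite fin_numElt (lt_le_trans _ K0) ?ltNy0//.
  apply: (@le_lt_trans _ _ (rb * h%:R + c)%:E); last exact: ltry.
  have /andP[b0 _] := W1_bd s0; have /andP[_ b1] := W1_bd s0.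
  rewrite -(esum_pmfZ pmf0); last by rewrite addr_ge0// (le_trans b0).
  apply: le_esum => s _; rewrite lee_fin ler_wpM2l// lerD2r.
  by have /andP[] := W1_bd s.
have q1 := sum_pmf q_pmf.
have up : (value q I piopt mu0 <= K + C%:E)%E.
  rewrite valueE// -[leRHS]integral_unit_cst; apply: le_integral_nonmeasurable => y _.
    apply: esum_ge0 => s _; rewrite lee_fin mulr_ge0//.
    by apply: (pval_ge0 _ YS_gt0 rew_bd).
  rewrite -(esum_pmfZ pmf0 C0) -esumD; last 2 first.
  - by move=> s _; rewrite lee_fin mulr_ge0.
  - by move=> s _; rewrite lee_fin mulr_ge0.
  apply: le_esum => s _; rewrite -EFinD lee_fin -mulrDr ler_wpM2l// -addrA.
  exact: pval_le_split.
have lo : (K <= value q I (temporal_concat (horizon I) pi1 pi2) mu0)%E.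
  have [N nN Ny] := temporal_concat_ae o1 o2 cW.
  rewrite valueE//; apply: integral_unit_ge nN _ => // y Dy.
    apply: esum_ge0 => s _; rewrite lee_fin mulr_ge0//.
    by apply: (pval_ge0 _ YS_gt0 rew_bd).
  by move=> nNy; apply: le_esum => s _; rewrite lee_fin ler_wpM2l//; exact: Ny.
rewrite /regret; apply: le_trans (leeB up lo) _.
by rewrite addeAC subee// add0e.
Qed.

End TemporalConcatenation.

Theorem theorem1 (R : realType) (S A : countType) (YS YR : finType)
    (q : YR -> R) (rbar : R) (I0 : mdp R S A YS YR) (mu0 : S -> R)
    (piopt pi1 pi2 : policy R S A)
    (YS_gt0 : (0 < #|YS|)%N) (q_pmf : is_pmf q)
    (rbar_ge0 : 0 <= rbar) (I0_rewards : rewards_in I0 rbar)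
    (T_even : ~~ odd (horizon I0)) (mu0_pmf : is_pmf mu0)
    (piopt_opt : optimal q I0 piopt)
    (pi1_opt : optimal q (first_half I0) pi1)
    (pi2_opt : optimal q (second_half I0) pi2) :
  (forall eps : R, 0 <= eps < 1 ->
     (eps_diameter I0 eps <= (horizon I0)./2)%N ->
     (regret q I0 piopt pi1 pi2 mu0 <=
        (rbar * (eps_diameter I0 eps)%:R / (1 - eps))%:E)%E)
  /\ ((eps_diameter I0 0 <= (horizon I0)./2)%N ->
      (regret q I0 piopt pi1 pi2 mu0 <=
         (rbar * (eps_diameter I0 0)%:R)%:E)%E).
Proof.
have [s0 _] := pmf_inhabited mu0_pmf.
have main (eps : R) : 0 <= eps < 1 -> (regret q I0 piopt pi1 pi2 mu0 <=
    (rbar * (eps_diameter I0 eps)%:R / (1 - eps))%:E)%E.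
  move=> eps01; apply: regret_le => //; last exact: eps_diameterP.
  exact: piopt 0%N s0 0.
split=> [eps eps01 _|_]; first exact: main.
by have := main 0; rewrite subr0 divr1; apply; rewrite lexx ltr01.
Qed.
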